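(* Let $\lambda$ be a nonzero cardinal, $(S,\tau_S)$ a Hausdorff semitopological monoid, $\theta\colon S\to H_S(1_S)$ a continuous homomorphism, and let $(\mathscr{P}_\lambda(\theta,S),\tau)$ be a topological Bruck–Reilly $\lambda$-polycyclic extension of $(S,\tau_S)$ in the class of Hausdorff semitopological semigroups. If $(S,\tau_S)$ contains a left (right, two-sided) ideal which is an $H$-closed semigroup in the class of Hausdorff semitopological semigroups, then for all words $u,v$ of the free monoid $\lambda^*$ the subset $S_{u^{-1}v}$ is open-and-closed in the topological space $(\mathscr{P}_\lambda(\theta,S),\tau)$.
   Context: A semitopological semigroup (monoid) is a semigroup (monoid) with a topology for which the operation is separately continuous. A Hausdorff semitopological semigroup $I$ is $H$-closed in the class of Hausdorff semitopological semigroups if every Hausdorff semitopological semigroup that contains $I$ (as a subsemigroup with the subspace topology) contains it as a closed subspace; an ideal of $S$ is considered with the subspace topology (ideals are non-empty). For a nonzero cardinal $\lambda$, $\lambda^*$ is the free monoid over the alphabet $\lambda$, $\varepsilon$ is the empty word and $|a|$ is the length of a word $a$. The $\lambda$-polycyclic monoid $P_\lambda$ is the semigroup with zero $0$ and identity $1$ generated by $\{p_i\}_{i\in\lambda}\cup\{p_i^{-1}\}_{i\in\lambda}$ subject to $p_ip_i^{-1}=1$ and $p_ip_j^{-1}=0$ for $i\ne j$ (for $\lambda=1$ it is the bicyclic monoid with adjoined zero). Identifying words of $\lambda^*$ with products of the $p_i$, each nonzero element of $P_\lambda$ is uniquely of the form $a^{-1}b$ with $a,b\in\lambda^*$; the identity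 of $P_\lambda$ is $\varepsilon=\varepsilon^{-1}\varepsilon$. For a monoid $S$ with identity $1_S$, $H_S(1_S)$ is its group of units. Given a homomorphism $\theta\colon S\to H_S(1_S)$, put $\theta^0(s)=s$ and $\theta^n=\theta\circ\cdots\circ\theta$ ($n$ times). The Bruck–Reilly $\lambda$-polycyclic extension is the set $\mathscr{P}_\lambda(\theta,S)=(S\times(P_\lambda\setminus\{0\}))\sqcup\{\boldsymbol{0}\}$ with the associative operation $*$ for which $\boldsymbol{0}$ is a zero and $$(s,a_1^{-1}a_2)*(t,b_1^{-1}b_2)=\begin{cases}(\theta^{|u|}(s)t,(ua_1)^{-1}b_2), & \text{if } b_1=ua_2 \text{ for some } u\in\lambda^*,\\ (s\theta^{|v|}(t),a_1^{-1}vb_2), & \text{if } a_2=vb_1 \text{ for some } v\in\lambda^*,\\ \boldsymbol{0}, & \text{otherwise.}\end{cases}$$ For $u,v\in\lambda^*$, $S_{u^{-1}v}=\{(s,u^{-1}v)\colon s\in S\}$. $(\mathscr{P}_\lambda(\theta,S),\tau)$ is a topological Bruck–Reilly $\lambda$-polycyclic extension of $(S,\tau_S)$ in a class $\mathfrak{STS}$ of semitopological semigroups if both $(S,\tau_S)$ and $(\mathscr{P}_\lambda(\theta,S),\tau)$ belong to $\mathfrak{STS}$ and the map $\Upsilon\colon(S,\tau_S)\to(\mathscr{P}_\lambda(\theta,S),\tau)$, $s\mapsto(s,\varepsilon)$, is a topological and algebraic embedding. *)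

(* Defs.v *)
From HB Require Import structures.
From mathcomp Require Import all_boot all_classical.
From mathcomp Require Import topology.

Set Implicit Arguments.
Unset Strict Implicit.
Unset Printing Implicit Defensive.

Import Algebra.

Local Open Scope classical_set_scope.
Local Open Scope group_scope.

(* No compatibility between the topology and the operation is built in here. *)
#[short(type="topSemigroupType")]
HB.structure Definition TopSemigroup := {T of Topological T & Semigroup T}.

#[short(type="topMonoidType")]
HB.structure Definition TopMonoid := {T of Topological T & Monoid T}.

Definition semitopological (X : topSemigroupType) : Prop :=
  (forall a : X, continuous (fun x : X => a * x)) /\
  (forall a : X, continuous (fun x : X => x * a)).

Definition hausdorff_semitopological (X : topSemigroupType) : Prop :=
  hausdorff_space X /\ semitopological X.

Definition topological_embedding (X Y : topologicalType) (f : X -> Y) : Prop :=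
  injective f /\
  forall U : set X, open U <-> exists2 V : set Y, open V & f @^-1` V = U.

Definition semigroup_embedding (X Y : topSemigroupType) (f : X -> Y) : Prop :=
  {morph f : x y / x * y} /\ topological_embedding f.

(* "X contains I as a subsemigroup with the subspace topology" is rendered by
   an embedding of I into X. *)
Definition H_closed (I : topSemigroupType) : Prop :=
  hausdorff_semitopological I /\
  forall (X : topSemigroupType) (f : I -> X),
    hausdorff_semitopological X -> semigroup_embedding f -> closed (range f).

Record subsemigroup (S : semigroupType) := Subsemigroup {
  subsemigroup_set :> set S;
  subsemigroupM : forall x y,
    subsemigroup_set x -> subsemigroup_set y -> subsemigroup_set (x * y)
}.

(* The subsemigroup as a semigroup of its own, with the subspace topology. *)
Definition subsemigroup_type (S : topSemigroupType) (I : subsemigroup S) : Type :=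
  set_type I.

Section SubsemigroupType.
Variables (S : topSemigroupType) (I : subsemigroup S).

HB.instance Definition _ := Topological.copy (subsemigroup_type I) (set_type I).
HB.instance Definition _ := SubChoice.copy (subsemigroup_type I) (set_type I).

Fact subsemigroup_mulg_closed : mulg_closed (fun x : S => x \in (I : set S)).
Proof.
by move=> x y /set_mem Ix /set_mem Iy; exact/mem_set/subsemigroupM.
Qed.

HB.instance Definition _ :=
  SubChoice_isSubSemigroup.Build S _ (subsemigroup_type I)
    subsemigroup_mulg_closed.

End SubsemigroupType.

Section Ideals.
Variable S : semigroupType.
Implicit Type A : set S.

Definition left_ideal A : Prop := A !=set0 /\ forall s x, A x -> A (s * x).

Definition right_ideal A : Prop := A !=set0 /\ forall s x, A x -> A (x * s).

Definition two_sided_ideal A : Prop := left_ideal A /\ right_ideal A.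

End Ideals.

Definition group_of_units (S : monoidType) : set S :=
  [set x | exists y, x * y = 1 /\ y * x = 1].
Arguments group_of_units : clear implicits.

Section Suffix.
Variable T : eqType.
Implicit Types a b c e u v w : seq T.

(* b is a suffix of c (left), c is a proper suffix of b (right), or neither. *)
Variant suffix_spec b c : bool -> bool -> Type :=
  | SuffixL u of c = u ++ b : suffix_spec b c true (suffix c b)
  | SuffixR v of b = v ++ c : suffix_spec b c false true
  | SuffixN of (forall u, c <> u ++ b) & (forall v, b <> v ++ c) :
      suffix_spec b c false false.

Lemma suffix_specP b c : suffix_spec b c (suffix b c) (suffix c b).
Proof.
case: (boolP (suffix b c)) => [/suffixP/cid [u e]|bc]; first exact: (SuffixL e).
case: (boolP (suffix c b)) => [/suffixP/cid [v e]|cb]; first exact: (SuffixR e).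
apply: SuffixN => u e; first by move/suffixP: bc; apply; exists u.
by move/suffixP: cb; apply; exists u.
Qed.

Lemma cat_comparable u b v c : u ++ b = v ++ c ->
  (exists w, c = w ++ b) \/ (exists w, b = w ++ c).
Proof.
elim: u v => [|x u IH] [|y v] //= e.
- by left; exists [::].
- by right; exists (y :: v).
- by left; exists (x :: u).
- by case: e => _; exact: IH.
Qed.

Lemma catIs b u v : u ++ b = v ++ b -> u = v.
Proof.
move=> e; have su : size u = size v.
  by apply: (@addIn (size b)); rewrite -!size_cat e.
by move/eqP: e; rewrite eqseq_cat// => /andP[/eqP].
Qed.

End Suffix.

(* Nonzero elements of the polycyclic monoid are written uniquely as a^-1 b and
   are encoded by the pair (a, b) of words; None is the zero of the extension. *)
Definition bruck_reilly (L : choiceType) (S : monoidType)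
  (theta : {multiplicative S -> S}) : Type := option (S * (seq L * seq L)).

Section BruckReilly.
Variables (L : choiceType) (S : monoidType) (theta : {multiplicative S -> S}).
Implicit Types (a b u v : seq L) (s t : S).

Local Notation BR := (bruck_reilly L theta).

HB.instance Definition _ := Choice.on BR.

Definition br_elt s a b : BR := Some (s, (a, b)).

(* The lemmas br_mulL, br_mulR and br_mulN below are the three cases of the rule
   of multiplication; u and v are recovered as the prefixes left over once the
   common suffix is removed. The first two cases overlap exactly for empty u and
   v, where they agree. *)
Definition br_mul (x y : BR) : BR :=
  match x, y with
  | Some (s, (a1, a2)), Some (t, (b1, b2)) =>
    if suffix a2 b1 then
      let u := take (size b1 - size a2) b1 in
      br_elt (iter (size u) theta s * t) (u ++ a1) b2
    else if suffix b1 a2 then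
      let v := take (size a2 - size b1) a2 in
      br_elt (s * iter (size v) theta t) a1 (v ++ b2)
    else None
  | _, _ => None
  end.

Lemma br_mulL s t a1 a2 u b2 :
  br_mul (br_elt s a1 a2) (br_elt t (u ++ a2) b2) =
  br_elt (iter (size u) theta s * t) (u ++ a1) b2.
Proof. by rewrite /= suffix_suffix size_cat addnK take_size_cat. Qed.

Lemma br_mulR s t a1 v b1 b2 :
  br_mul (br_elt s a1 (v ++ b1)) (br_elt t b1 b2) =
  br_elt (s * iter (size v) theta t) a1 (v ++ b2).
Proof.
rewrite /= suffix_suffix size_cat addnK take_size_cat//.
case: ifP => // /suffixP[u e].
have /eqP : size b1 = size (u ++ v ++ b1) by rewrite -e.
rewrite !size_cat addnA -[X in X == _]add0n eqn_add2r eq_sym addn_eq0.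
move=> /andP[/nilP u0 /nilP v0]; subst u v => /=.
by rewrite subnn take0.
Qed.

Lemma br_mulN s t a1 a2 b1 b2 :
  (forall u, b1 <> u ++ a2) -> (forall v, a2 <> v ++ b1) ->
  br_mul (br_elt s a1 a2) (br_elt t b1 b2) = None.
Proof.
move=> h1 h2 /=; case: ifP => [/suffixP[u /h1]//|_].
by case: ifP => [/suffixP[v /h2]|].
Qed.

Lemma br_mul0l y : br_mul None y = None.
Proof. by []. Qed.

Lemma br_mul0r x : br_mul x None = None.
Proof. by case: x => [[s [a b]]|]. Qed.

Let iterM n : {morph iter n theta : s t / s * t}.
Proof. by elim: n => // n IH s t; rewrite /= IH gmulfM. Qed.

Fact br_mulA : associative br_mul.
Proof.
move=> [[s [a b]]|] //.
move=> [[t [c d]]|] //.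
move=> [[r [e f]]|]; last by rewrite (br_mul0r (br_mul _ _)) (br_mul0r (Some (t, _))).
change (br_mul (br_elt s a b) (br_mul (br_elt t c d) (br_elt r e f)) =
        br_mul (br_mul (br_elt s a b) (br_elt t c d)) (br_elt r e f)).
case: (suffix_specP b c) => [u|v|bc cb].
- case: (suffix_specP d e) => [w -> ->|w -> ->|de ed ->].
  + by rewrite !br_mulL (catA w u b) br_mulL iterM size_cat iterD !mulgA catA.
  + by rewrite br_mulR !br_mulL br_mulR !mulgA.
  + by rewrite br_mulL !br_mulN// br_mul0r.
- case: (suffix_specP d e) => [w -> ->|w -> ->|de ed ->].
  + rewrite br_mulL br_mulR; case: (suffix_specP v w) => [w' ->|v' ->|vw wv].
    * by rewrite -!catA !br_mulL iterM size_cat iterD !mulgA.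
    * by rewrite -!catA !br_mulR iterM size_cat iterD !mulgA.
    * by rewrite !br_mulN// => k; rewrite catA => /catIs;
        first [exact: wv | exact: vw].
  + by rewrite !br_mulR (catA v w e) br_mulR iterM size_cat iterD !mulgA catA.
  + rewrite br_mulR [br_mul (br_elt t _ _) _]br_mulN// br_mul0r br_mulN//.
    * by move=> k; rewrite catA => /de.
    * move=> k /cat_comparable[] [w]; [exact: de|exact: ed].
- rewrite [br_mul (br_elt s _ _) (br_elt t _ _)]br_mulN// br_mul0l.
  case: (suffix_specP d e) => [w ->|w ->|de ed].
  + rewrite br_mulL br_mulN//.
    * by move=> k /cat_comparable[] [x]; [exact: cb|exact: bc].
    * by move=> k; rewrite catA => /cb.
  + by rewrite br_mulR br_mulN.
  + by rewrite [br_mul (br_elt t _ _) _]br_mulN// br_mul0r.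
Qed.

HB.instance Definition _ := isSemigroup.Build BR br_mulA.

Definition Upsilon s : BR := br_elt s [::] [::].

Definition br_component u v : set BR := [set br_elt s u v | s in [set: S]].

End BruckReilly.
Arguments br_component {L S} theta u v.

(* Topologies on T, given by their systems of open sets. *)
Definition topology_on (T : semigroupType) : Type := isOpenTopological T.

(* The semigroup T equipped with the topology tau. *)
Definition topologized (T : semigroupType) (tau : topology_on T) : Type := T.

Section Topologized.
Variables (T : semigroupType) (tau : topology_on T).
HB.instance Definition _ := Semigroup.on (topologized tau).
HB.instance Definition _ : isOpenTopological (topologized tau) := tau.
End Topologized.

(* tau makes the Bruck-Reilly extension of S a topological one, in the class of
   Hausdorff semitopological semigroups. *)
Definition topological_bruck_reilly (L : choiceType) (S : topMonoidType)
    (theta : {multiplicative S -> S})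
    (tau : topology_on (bruck_reilly L theta)) : Prop :=
  [/\ hausdorff_semitopological S,
      hausdorff_semitopological (topologized tau) &
      semigroup_embedding (Upsilon L theta : S -> topologized tau)].

(* Main.v *)
(** Let [e = (1, p^-1 p)] for a letter [p]. The complement of [S_eps] is the
    union of the four closed sets [x e = x], [x e = 0], [e x = x], [e x = 0],
    so [S_eps] is open. If [a] lies in a left ideal [I], then [S_eps] is the
    preimage of the closed copy of [I] under [x |-> x (a, eps)], so [S_eps] is
    closed; right ideals are symmetric. The preimage [C u v] of [S_eps] under
    [x |-> (1, u) x (1, v^-1)] is the union of the [S_{a^-1 b}] over the
    decompositions [u = w a], [v = w b]. Hence [S_{u^-1 v}] is [C u v] minus
    [C u' v'] when [u = p u'] and [v = p v'] for some letter [p], and is [C u v]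
    itself otherwise. *)
Require Import Defs.
From mathcomp Require Import all_boot all_classical.
From mathcomp Require Import topology.

Import Algebra.

Local Open Scope classical_set_scope.

Lemma closed_equalizer (X Y : topologicalType) (f g : X -> Y) :
  hausdorff_space Y -> continuous f -> continuous g ->
  closed [set x | f x = g x].
Proof.
move=> hY cf cg x xcl; apply: hY => A B nA nB.
have [y [/= fgy [Ay By]]] := xcl _ (@filterI _ (nbhs x) _ _ _ (cf x A nA) (cg x B nB)).
by exists (f y); split=> //; rewrite fgy.
Qed.

Lemma semigroup_embedding_comp (X Y Z : topSemigroupType)
    (f : X -> Y) (g : Y -> Z) :
  semigroup_embedding f -> semigroup_embedding g ->
  semigroup_embedding (g \o f).
Proof.
move=> [fM [fI fO]] [gM [gI gO]]; split; first by move=> x y /=; rewrite fM gM.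
split; first exact: inj_comp.
move=> U; split.
- by move=> /fO[V /gO[W oW <-] <-]; exists W.
- by move=> [W oW <-]; apply/fO; exists (g @^-1` W) => //; apply/gO; exists W.
Qed.

Lemma subsemigroup_val_embedding (S : topSemigroupType) (I : subsemigroup S) :
  semigroup_embedding (val : subsemigroup_type I -> S).
Proof. by split; [move=> x y|split; [exact: val_inj|]]. Qed.

Lemma range_subsemigroup_val (S : topSemigroupType) (I : subsemigroup S) :
  range (val : subsemigroup_type I -> S) = I.
Proof.
apply/seteqP; split=> [_ [x _ <-]|x Ix]; first exact: set_valP.
by exists (exist _ x (mem_set Ix)).
Qed.

(** A [{multiplicative S -> S}] map is only known to preserve products. Still, [theta 1] is an
    idempotent and has a right inverse [y], and cancelling [y] leaves [1]. *)
Lemma range_units_gmulf1 (S : monoidType) (theta : {multiplicative S -> S}) :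
  range theta `<=` group_of_units S -> theta 1%g = 1%g.
Proof.
move=> /(_ (theta 1%g)); case; first by exists 1%g.
move=> y [e _].
by rewrite -[LHS]mulg1 -[X in (_ * X)%g]e mulgA -gmulfM mulg1.
Qed.

Lemma cats1_neq (T : eqType) (p q : T) (a b : seq T) :
  q != p -> a ++ [:: q] <> b ++ [:: p].
Proof. by move=> qp /eqP; rewrite !cats1 eqseq_rcons (negPf qp) andbF. Qed.

Section BruckReilly.
Variables (L : choiceType) (S : monoidType) (theta : {multiplicative S -> S}).
Implicit Types (a b u v w : seq L) (s t : S) (p : L).

Local Notation BR := (bruck_reilly L theta).
Local Notation elt := (br_elt theta).

Lemma br_componentP u v (x : BR) :
  br_component theta u v x <-> exists s, x = elt s u v.
Proof. by split=> [[s _ <-]|[s ->]]; exists s. Qed.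

Lemma br_component_nil_mulr (A : set S) s :
  (forall t, A (t * s)%g) ->
  br_component theta [::] [::] =
  [set x : BR | (Upsilon L theta @` A) (x * Upsilon L theta s)%g].
Proof.
move=> At; apply/seteqP; split=> [_ [t _ <-]|[[t [a b]]|] [r Ar]] //=.
  by exists (t * s)%g.
change (Upsilon L theta r = br_mul (elt t a b) (elt s [::] [::]) ->
        br_component theta [::] [::] (elt t a b)).
rewrite -{1}[b]cats0 br_mulR cats0 => -[_ <- <-]; exact: imageT.
Qed.

Lemma br_component_nil_mull (A : set S) s :
  (forall t, A (s * t)%g) ->
  br_component theta [::] [::] =
  [set x : BR | (Upsilon L theta @` A) (Upsilon L theta s * x)%g].
Proof.
move=> At; apply/seteqP; split=> [_ [t _ <-]|[[t [a b]]|] [r Ar]] //=.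
  by exists (s * t)%g.
change (Upsilon L theta r = br_mul (elt s [::] [::]) (elt t a b) ->
        br_component theta [::] [::] (elt t a b)).
rewrite -{1}[a]cats0 br_mulL cats0 => -[_ <- <-]; exact: imageT.
Qed.

(** The last letter [q] of [b], or of [a] when [b] is empty, decides: multiplying by [e] on that
    side fixes [x] if [q = p] (here [theta 1 = 1] enters) and gives zero if not. *)
Lemma setC_br_component_nil p : theta 1%g = 1%g ->
  let e : BR := elt 1%g [:: p] [:: p] in
  ~` br_component theta [::] [::] =
  [set x : BR | (x * e)%g = x] `|` [set x : BR | (x * e)%g = None] `|`
  ([set x : BR | (e * x)%g = x] `|` [set x : BR | (e * x)%g = None]).
Proof.
move=> th1 e; apply/seteqP; split.
  case=> [[s [a b]]|_]; last by do 2!left.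
  change (~ br_component theta [::] [::] (elt s a b) ->
   (br_mul (elt s a b) e = elt s a b \/ br_mul (elt s a b) e = None) \/
   (br_mul e (elt s a b) = elt s a b \/ br_mul e (elt s a b) = None)).
  case: (lastP b) => [|b' q].
    case: (lastP a) => [|a' q] nS; first by case: nS; exact: imageT.
    right; rewrite -cats1; have [->|qp] := eqVneq q p.
      by left; rewrite /e br_mulL iter_fix // mul1g.
    right; apply: br_mulN => [u|v]; first exact: cats1_neq.
    by rewrite catA -[[:: p]]cat0s; apply: cats1_neq; rewrite eq_sym.
  move=> _; left; rewrite -cats1; have [->|qp] := eqVneq q p.
    by left; rewrite /e br_mulR iter_fix // mulg1.
  right; apply: br_mulN => [u|v]; last exact: cats1_neq.
  by rewrite catA -[[:: p]]cat0s; apply: cats1_neq; rewrite eq_sym.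
move=> x hx [s _ xE]; move: hx; rewrite -{}xE.
(* With [[:: p]] split as [[:: p] ++ [::]], both product rules apply. Each product has both words
   equal to [p], so it is neither [(s, eps)] nor zero. *)
change ((br_mul (elt s [::] [::]) (elt 1%g ([:: p] ++ [::]) [:: p]) =
           elt s [::] [::] \/
         br_mul (elt s [::] [::]) (elt 1%g ([:: p] ++ [::]) [:: p]) = None) \/
        (br_mul (elt 1%g [:: p] ([:: p] ++ [::])) (elt s [::] [::]) =
           elt s [::] [::] \/
         br_mul (elt 1%g [:: p] ([:: p] ++ [::])) (elt s [::] [::]) = None) ->
        False).
by rewrite br_mulL br_mulR => -[] [].
Qed.

Definition br_shift u v (x : BR) : BR :=
  (elt 1%g [::] u * x * elt 1%g v [::])%g.

(** Only the words matter. If [u = w ++ a], the left factor turns [a^-1 b] into [w b], and [v^-1]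
    cancels this completely only for [v = w ++ b]. If [a = w ++ u], the word [w] survives on the
    left, so it must be empty. *)
Lemma br_shiftP u v (x : BR) :
  br_component theta [::] [::] (br_shift u v x) <->
  exists s w a b, [/\ x = elt s a b, u = w ++ a & v = w ++ b].
Proof.
split; last first.
  move=> [s [w [a [b [-> -> ->]]]]].
  change (br_component theta [::] [::]
    (br_mul (br_mul (elt 1%g [::] (w ++ a)) (elt s a b))
            (elt 1%g (w ++ b) [::]))).
  by rewrite br_mulR (br_mulR theta _ _ [::] [::]); exact: imageT.
case: x => [[s [a b]]|/br_componentP[]] //.
change (br_component theta [::] [::]
    (br_mul (br_mul (elt 1%g [::] u) (elt s a b)) (elt 1%g v [::])) ->
  exists s' w a' b', [/\ elt s a b = elt s' a' b', u = w ++ a' & v = w ++ b']).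
case: (suffix_specP u a) => [w ->|w ->|h1 h2]; last first.
- by rewrite br_mulN// => /br_componentP[].
- rewrite br_mulR; case: (suffix_specP (w ++ b) v) => [k ->|k wb|h1 h2].
  + rewrite br_mulL => /br_componentP[t [_]]; rewrite cats0 => ->.
    by exists s, w, a, b.
  + rewrite wb br_mulR => /br_componentP[t [_]]; rewrite cats0 => k0.
    by exists s, w, a, b; split=> //; rewrite wb k0.
  + by rewrite br_mulN// => /br_componentP[].
- rewrite br_mulL cats0; case: (suffix_specP b v) => [k ->|k ->|h1 h2].
  + rewrite br_mulL => /br_componentP[t [_ /nilP]].
    rewrite /nilp size_cat addn_eq0 => /andP[/nilP -> /nilP ->].
    by exists s, [::], u, b.
  + rewrite br_mulR => /br_componentP[t [_ -> ]]; rewrite cats0 => ->.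
    by exists s, [::], u, v.
  + by rewrite br_mulN// => /br_componentP[].
Qed.

(** A nonempty [w] in a decomposition of [u] and [v] begins with a common first letter; deleting
    that letter gives exactly the decompositions of [u'] and [v']. What remains is the case of empty
    [w]. *)
Lemma br_component_shift u v :
  br_component theta u v = br_shift u v @^-1` br_component theta [::] [::] \/
  exists u' v',
    br_component theta u v = br_shift u v @^-1` br_component theta [::] [::] `\`
                             br_shift u' v' @^-1` br_component theta [::] [::].
Proof.
have sub : br_component theta u v `<=`
    br_shift u v @^-1` br_component theta [::] [::].
  by move=> _ [s _ <-]; apply/br_shiftP; exists s, [::], u, v.
have [[p [u' [v' [uE vE]]]]|ne] :=
    pselect (exists p u' v', u = p :: u' /\ v = p :: v').
- right; exists u', v'; apply/seteqP; split=> [x xuv|x [/br_shiftP]].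
    split; first exact: sub.
    (* Otherwise [u' = w ++ u], although [u] is one letter longer than [u']. *)
    move/br_componentP: xuv => [s ->] /br_shiftP[t [w [a [b [[_ <- _]]]]]].
    move=> /(congr1 size) /eqP; rewrite uE size_cat /= addnS.
    by rewrite -addSn -[X in X == _]add0n eqn_add2r.
  move=> [s [[|q w] [a [b [-> ]]]]]; rewrite uE vE.
    by move=> -> -> _; exact: imageT.
  move=> [_ u'E] [_ v'E] []; apply/br_shiftP.
  by exists s, w, a, b.
- left; apply/seteqP; split=> // x /br_shiftP[s [[|q w] [a [b [-> uE vE]]]]].
    by rewrite uE vE; exact: imageT.
  by case: ne; exists q, (w ++ a), (w ++ b).
Qed.

End BruckReilly.
Arguments br_shift {L S} theta u v x.

(** Each of the four sets is the equalizer of a translation by [e] with the identity or with the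
    constant zero map, hence closed in a Hausdorff space. *)
Lemma open_br_component_nil (L : choiceType) (S : topMonoidType)
    (theta : {multiplicative S -> S})
    (tau : topology_on (bruck_reilly L theta)) :
  hausdorff_semitopological (topologized tau) ->
  inhabited L -> theta 1%g = 1%g ->
  open (br_component theta [::] [::] : set (topologized tau)).
Proof.
set X := topologized tau; move=> [hX [cl cr]] [p] th1.
rewrite -[X in open X]setCK; apply: closed_openC.
have := @setC_br_component_nil L S theta p th1 => /= ->.
have cid : continuous (fun x : X => x) by move=> x; exact: cvg_id.
have c0 : continuous (fun _ : X => None : X) := @cst_continuous X X None.
apply: (@closedU X); apply: (@closedU X).
- exact: (@closed_equalizer X X _ _ hX (cr _) cid).
- exact: (@closed_equalizer X X _ _ hX (cr _) c0).
- exact: (@closed_equalizer X X _ _ hX (cl _) cid).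
- exact: (@closed_equalizer X X _ _ hX (cl _) c0).
Qed.

Lemma closed_br_component_nil (L : choiceType) (S : topMonoidType)
    (theta : {multiplicative S -> S})
    (tau : topology_on (bruck_reilly L theta)) (I : subsemigroup S) :
  topological_bruck_reilly tau ->
  left_ideal I \/ right_ideal I -> H_closed (subsemigroup_type I) ->
  closed (br_component theta [::] [::] : set (topologized tau)).
Proof.
set X := topologized tau; move=> [_ X_hst emb] ideal [_ /(_ X)].
(* H-closedness is applied to the composite embedding of [I] into [S] and then into the
   extension. *)
move=> /(_ _ X_hst 
  (semigroup_embedding_comp _ _ _ _ _ (subsemigroup_val_embedding S I) emb)).
move=> Icl0.
have Icl : closed (Upsilon L theta @` I : set X).
  by rewrite -(range_subsemigroup_val S I) image_comp.
case: X_hst => _ [cl cr].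
case: ideal => -[[s Is] sI].
- have -> := @br_component_nil_mulr L S theta I s (fun t => sI t s Is).
  exact: (continuous_closedP _).1 (cr _) _ Icl.
- have -> := @br_component_nil_mull L S theta I s (fun t => sI t s Is).
  exact: (continuous_closedP _).1 (cl _) _ Icl.
Qed.

Theorem mainTheorem12 (L : choiceType) (S : topMonoidType)
    (theta : {multiplicative S -> S})
    (tau : topology_on (bruck_reilly L theta)) :
  inhabited L ->
  hausdorff_semitopological S ->
  range theta `<=` group_of_units S ->
  continuous theta ->
  topological_bruck_reilly tau ->
  (exists I : subsemigroup S,
     (left_ideal I \/ right_ideal I \/ two_sided_ideal I) /\
     H_closed (subsemigroup_type I)) ->
  forall u v : seq L,
    clopen (br_component theta u v : set (topologized tau)).
Proof.
move=> L0 _ thU _ top [I [ideal IH]] u v.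
have [_ X_hst _] := top.
have LR : left_ideal I \/ right_ideal I by case: ideal => [|[|[]]]; tauto.
have S0 : clopen (br_component theta [::] [::] : set (topologized tau)).
  split; first by apply: open_br_component_nil => //; exact: range_units_gmulf1.
  exact: closed_br_component_nil LR IH.
have shift_clopen a b : clopen (br_shift theta a b @^-1`
      br_component theta [::] [::] : set (topologized tau)).
  (* A shift is a left translation followed by a right one, so separate continuity suffices. *)
  have [_ [cl cr]] := X_hst.
  apply: (@preimage_clopen (topologized tau) (topologized tau)) => // x.
  exact: (@continuous_comp _ (topologized tau) (topologized tau) _ _ x
            (cl _ x) (cr (br_elt theta 1%g b [::]) _)).
case: (br_component_shift L S theta u v) => [->//|[u' [v' ->]]].
rewrite setDE.
apply: (@clopenI (topologized tau)); first exact: shift_clopen.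
apply: (@clopenC (topologized tau) _ set0); exact: shift_clopen.
Qed.
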